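(* Let $\omega>0$ be constant, let $m\ge 2$ be an integer, and let $g:\mathbb{R}\to\mathbb{R}$ be continuous and $2\pi$-periodic with $g(t)\neq 0$. Consider the equation $$z''+\omega^2 z+g(t)\,z^m=0.$$ Invariants of this equation that are quadratic in $p=z'$ (as defined in the context) exist precisely when $$\alpha_2(t):=g(t)^{-2/(m+3)}$$ satisfies the linear third-order ODE $$\alpha_2'''+4\omega^2\alpha_2'=0.$$ This yields the three-parameter solution $$g(t)=\big[A+B\cos(2\omega t)+C\sin(2\omega t)\big]^{-(m+3)/2}$$ with real constants $A,B,C$. For $m=2$ this is the trigonometric structure with exponent $-5/2$.
   Context: Write $p=z'$. An invariant quadratic in $p$ of the equation $z''+\omega^2 z+g(t)z^m=0$ is a first integral of the form $$I(z,p,t)=a_0(z,t)+a_1(z,t)\,p+a_2(z,t)\,p^2,\qquad \frac{dI}{dt}=0,$$ where $dI/dt$ is the derivative along solutions $z(t)$ of the equation.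
   Formalization: Since g may be negative, where real powers of g are undefined or the formula fails (e.g. g=-1), |g| replaces g in α₂ and in the three-parameter formula (bracket positive); the coefficients of the invariant are taken C¹ with a₂ not identically zero. *)

(* Defs.v *)
From Stdlib Require Import Reals.
From Coquelicot Require Import Coquelicot.
Open Scope R_scope.

(* z is a classical solution of z'' + omega^2 z + g(t) z^m = 0 on the open
   interval (a, b).  Arbitrary, possibly bounded, intervals are needed because
   solutions may blow up in finite time.  ex_derive_n z 2 t only says that the
   total function Derive z is derivable at t, hence the separate ex_derive. *)
Definition is_solution (omega : R) (m : nat) (g : R -> R) (a b : Rbar)
    (z : R -> R) : Prop :=
  forall t : R, Rbar_lt a t -> Rbar_lt t b ->
    ex_derive z t /\ ex_derive_n z 2 t /\
    Derive_n z 2 t + omega ^ 2 * z t + g t * z t ^ m = 0.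

Definition C1_2d (f : R -> R -> R) : Prop :=
  forall x t : R,
    ex_derive (fun y => f y t) x /\
    ex_derive (fun s => f x s) t /\
    continuity_2d_pt (fun y s => Derive (fun y' => f y' s) y) x t /\
    continuity_2d_pt (fun y s => Derive (fun s' => f y s') s) x t.

(* The condition that a2 is not identically zero is what "quadratic" means:
   without it, constants would always be invariants. *)
Definition is_quadratic_invariant (omega : R) (m : nat) (g : R -> R)
    (a0 a1 a2 : R -> R -> R) : Prop :=
  C1_2d a0 /\ C1_2d a1 /\ C1_2d a2 /\
  (exists z t : R, a2 z t <> 0) /\
  forall (a b : Rbar) (z : R -> R), is_solution omega m g a b z ->
    forall t : R, Rbar_lt a t -> Rbar_lt t b ->
      is_derive (fun s => a0 (z s) s + a1 (z s) s * Derive z s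
                          + a2 (z s) s * Derive z s ^ 2) t 0.

Definition has_quadratic_invariant (omega : R) (m : nat) (g : R -> R) : Prop :=
  exists a0 a1 a2 : R -> R -> R, is_quadratic_invariant omega m g a0 a1 a2.

(* g^{-2/(m+3)}.  Rpower is meaningful for positive bases only; g may be
   negative, and the absolute value is the reading of the power that makes
   sense for every m and either sign of g. *)
Definition alpha2 (m : nat) (g : R -> R) (t : R) : R :=
  Rpower (Rabs (g t)) (- 2 / (INR m + 3)).

Definition solves_third_order_ode (omega : R) (alpha : R -> R) : Prop :=
  forall t : R,
    (forall k : nat, (k <= 3)%nat -> ex_derive_n alpha k t) /\
    Derive_n alpha 3 t + 4 * omega ^ 2 * Derive_n alpha 1 t = 0.

Definition trig (omega A B C t : R) : R :=
  A + B * cos (2 * omega * t) + C * sin (2 * omega * t).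

(* Main.v *)
Require Import Defs.
From Stdlib Require Import Reals Lra Lia.
From Coquelicot Require Import Coquelicot.
Open Scope R_scope.

(** Differentiating an invariant [a0 + a1 p + a2 p ^ 2] along a solution gives a
    cubic polynomial in [p].  Since a solution passes through every point with
    every velocity ([local_solution], a Picard iteration), all its coefficients
    vanish ([determining_equations]).  Integrating them in [z] expresses the
    invariant through two functions of time, [al] and [be] ([invariant_structure]):
    [a2 = al], [a1 = be - al' z], with

      [(al g)' = - (m + 1) / 2 al' g],   [be'' + omega ^ 2 be = 0],
      [al''' + 4 omega ^ 2 al' = 2 be g],   and [be = 0] unless [m = 2].

    The first relation makes [g ^ 2 al ^ (m + 3)] constant, so [al] is a nonzero
    constant multiple of [alpha2] ([proportional_to_alpha2]).  For [m > 2] this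
    gives the third-order equation for [alpha2], and conversely any solution of
    it, taken with [be = 0], gives an invariant ([ode_invariant]).

    For [m = 2] the forcing [2 be g] has to be excluded, and this is where the
    periodicity of [g] enters ([no_periodic_resonance]).  It passes to [al] and
    [be].  In suitable coordinates the equation for [al] becomes the motion of a
    particle in a cubic potential, and a periodic [be] that is not zero would make
    the period of that motion stationary as a function of the energy.
    [oscillator_rigidity] rules this out by a periodic function whose derivative
    has a constant sign and vanishes only where [be] does.

    The trigonometric form of [g] is the general solution of the third-order
    equation ([ode_trig], [trig_ode]), read through
    [|g| = alpha2 ^ (- (m + 3) / 2)]. *)

(** * Differentiation and continuity on the line *)

Lemma ex_derive_eq (f k : R -> R) (t : R) :
  (forall s, f s = k s) -> ex_derive f t -> ex_derive k t.
Proof. exact (ex_derive_ext f k t). Qed.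

Lemma is_derive_eq (f k : R -> R) (t l : R) :
  (forall s, f s = k s) -> is_derive f t l -> is_derive k t l.
Proof. exact (is_derive_ext f k t l). Qed.

Lemma derive_zero_const (f : R -> R) :
  (forall t, is_derive f t 0) -> forall s t, f s = f t.
Proof.
  intros H s t. destruct (Rtotal_order s t) as [Hst|[->|Hst]]; [|reflexivity|symmetry];
    apply (eq_is_derive f); auto; intros; apply H.
Qed.

(** [auto_derive] leaves terms [Derive f t]; their values are taken from the
    [is_derive] facts in the context. *)
Ltac use_derivatives :=
  repeat match goal with
  | H : is_derive ?f ?t ?l |- context [Derive ?g ?t] =>
      change (Derive g t) with (Derive f t); rewrite (is_derive_unique f t l H)
  end.

Tactic Notation "derive_by" tactic(tac) :=
  auto_derive;
  [repeat split;
   first [exact I | assumption | eexists; eassumption | lra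
         |apply Rgt_not_eq; nra]
  |use_derivatives; tac].

Lemma continuous_abs_intro (f : R -> R) (x : R) :
  (forall eps, 0 < eps -> exists d, 0 < d /\
     forall y, Rabs (y - x) < d -> Rabs (f y - f x) < eps) ->
  continuous f x.
Proof.
  intros H. apply continuity_pt_filterlim. intros eps He.
  destruct (H eps He) as [d [Hd Hy]]. exists d; split; [exact Hd|].
  intros y [_ Hxy]. exact (Hy y Hxy).
Qed.

Lemma continuous_abs_elim (f : R -> R) (x eps : R) :
  continuous f x -> 0 < eps -> exists d, 0 < d /\
     forall y, Rabs (y - x) < d -> Rabs (f y - f x) < eps.
Proof.
  intros Hf He. apply continuity_pt_filterlim in Hf.
  destruct (Hf eps He) as [d [Hd Hy]]. exists d; split; [exact Hd|].
  intros y Hxy. destruct (Req_dec x y) as [->|Hne].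
  - rewrite Rminus_diag, Rabs_R0; exact He.
  - apply (Hy y). split; [split; [exact I|exact Hne]|exact Hxy].
Qed.

Lemma continuous_Lipschitz (f : R -> R) (L x : R) :
  (forall y, Rabs (f y - f x) <= L * Rabs (y - x)) -> continuous f x.
Proof.
  intros H. apply continuous_abs_intro. intros eps He.
  assert (HL : 0 < Rabs L + 1) by (generalize (Rabs_pos L); lra).
  exists (eps / (Rabs L + 1)). split.
  - apply Rdiv_lt_0_compat; lra.
  - intros y Hy. apply Rle_lt_trans with (1 := H y).
    apply Rle_lt_trans with ((Rabs L + 1) * Rabs (y - x)).
    + apply Rmult_le_compat_r; [apply Rabs_pos|].
      generalize (Rle_abs L); lra.
    + apply Rmult_lt_compat_l with (r := Rabs L + 1) in Hy; [|exact HL].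
      replace ((Rabs L + 1) * (eps / (Rabs L + 1))) with eps in Hy by (field; lra).
      exact Hy.
Qed.

(** * Local existence of solutions *)

Definition clamp (lo hi x : R) : R := Rmax lo (Rmin hi x).

Lemma clamp_bounds (lo hi x : R) : lo <= hi -> lo <= clamp lo hi x <= hi.
Proof.
  intros H. unfold clamp, Rmax, Rmin.
  repeat destruct Rle_dec; lra.
Qed.

Lemma clamp_id (lo hi x : R) : lo <= x <= hi -> clamp lo hi x = x.
Proof.
  intros H. unfold clamp, Rmax, Rmin.
  repeat destruct Rle_dec; lra.
Qed.

Lemma clamp_contract (lo hi x y : R) :
  Rabs (clamp lo hi y - clamp lo hi x) <= Rabs (y - x).
Proof.
  unfold clamp, Rmax, Rmin.
  repeat destruct Rle_dec; unfold Rabs; repeat destruct Rcase_abs; lra.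
Qed.

Lemma continuous_clamp (lo hi x : R) : continuous (clamp lo hi) x.
Proof.
  apply continuous_Lipschitz with 1. intros y. rewrite Rmult_1_l.
  apply clamp_contract.
Qed.

Lemma lim_halves (k : R) : is_lim_seq (fun n => k * (/ 2) ^ n) 0.
Proof.
  replace (Finite 0) with (Rbar_mult k 0) by (simpl; f_equal; ring).
  apply is_lim_seq_scal_l, is_lim_seq_geom. rewrite Rabs_pos_eq; lra.
Qed.

(** Geometric domination makes the sequence uniformly Cauchy, and a uniform
    limit of continuous functions is continuous. *)
Lemma geometric_uniform_limit (u : nat -> R -> R) (D : R) :
  (forall n t, continuous (u n) t) ->
  (forall n t, Rabs (u (S n) t - u n t) <= D * (/ 2) ^ n) ->
  exists z : R -> R, (forall t, continuous z t) /\
    forall n t, Rabs (z t - u n t) <= 2 * D * (/ 2) ^ n.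
Proof.
  intros Hc Hu.
  assert (HD : 0 <= D).
  { generalize (Hu O 0) (Rabs_pos (u 1%nat 0 - u O 0)); simpl; lra. }
  assert (Hk : forall k n t,
    Rabs (u (n + k)%nat t - u n t) <= 2 * D * (/ 2) ^ n * (1 - (/ 2) ^ k)).
  { induction k; intros n t.
    - rewrite Nat.add_0_r, Rminus_diag, Rabs_R0. simpl. lra.
    - replace (u (n + S k)%nat t - u n t) with
        ((u (S (n + k)) t - u (n + k)%nat t) + (u (n + k)%nat t - u n t))
        by (rewrite Nat.add_succ_r; ring).
      apply Rle_trans with (1 := Rabs_triang _ _).
      apply Rle_trans with (1 := Rplus_le_compat _ _ _ _ (Hu _ _) (IHk _ _)).
      right. rewrite pow_add; simpl; field. }
  assert (Hk' : forall k n t,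
    Rabs (u (n + k)%nat t - u n t) <= 2 * D * (/ 2) ^ n).
  { intros k n t. apply Rle_trans with (1 := Hk k n t).
    assert (0 < (/ 2) ^ k) by (apply pow_lt; lra).
    assert (0 < (/ 2) ^ n) by (apply pow_lt; lra).
    assert (0 <= 2 * D * (/ 2) ^ n) by (apply Rmult_le_pos; lra).
    nra. }
  assert (Hsmall : forall eps, 0 < eps -> exists n, 2 * D * (/ 2) ^ n < eps).
  { intros eps He.
    generalize (lim_halves (2 * D)); intros H0.
    apply is_lim_seq_spec in H0. destruct (H0 (mkposreal eps He)) as [n Hn].
    exists n. specialize (Hn n (le_n n)). simpl in Hn.
    rewrite Rminus_0_r in Hn. apply Rle_lt_trans with (1 := Rle_abs _) (2 := Hn). }
  assert (Hlim : forall t, exists l : R, is_lim_seq (fun n => u n t) l).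
  { intros t. apply ex_lim_seq_cauchy_corr. intros eps.
    destruct (Hsmall (eps / 2)) as [N HN].
    { destruct eps as [e He]; simpl; lra. }
    exists N. intros n p Hn Hp.
    replace n with (N + (n - N))%nat by lia.
    replace p with (N + (p - N))%nat by lia.
    replace (u (N + (n - N))%nat t - u (N + (p - N))%nat t) with
      ((u (N + (n - N))%nat t - u N t) - (u (N + (p - N))%nat t - u N t)) by ring.
    apply Rle_lt_trans with (1 := Rabs_triang _ _).
    rewrite Rabs_Ropp.
    generalize (Hk' (n - N)%nat N t) (Hk' (p - N)%nat N t). lra. }
  exists (fun t => Lim_seq (fun n => u n t)).
  assert (Hz : forall n t,
    Rabs (real (Lim_seq (fun n => u n t)) - u n t) <= 2 * D * (/ 2) ^ n).
  { intros n t. destruct (Hlim t) as [l Hl].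
    rewrite (is_lim_seq_unique _ _ Hl). simpl.
    assert (H1 : is_lim_seq (fun k => Rabs (u (n + k)%nat t - u n t)) (Rabs (l - u n t))).
    { apply (is_lim_seq_abs _ (Finite (l - u n t))).
      apply is_lim_seq_minus'; [|apply is_lim_seq_const].
      apply (is_lim_seq_incr_n (fun n => u n t) n) in Hl.
      apply is_lim_seq_ext with (2 := Hl). intros k. now rewrite Nat.add_comm. }
    exact (is_lim_seq_le _ _ _ _ (fun k => Hk' k n t) H1 (is_lim_seq_const _)). }
  split; [|exact Hz].
  intros t. apply continuous_abs_intro. intros eps He.
  destruct (Hsmall (eps / 3)) as [n Hn]; [lra|].
  destruct (continuous_abs_elim _ _ (eps / 3) (Hc n t)) as [d [Hd Hy]]; [lra|].
  exists d; split; [exact Hd|]. intros y Hyt.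
  match goal with |- Rabs (?A - ?B) < _ =>
    replace (A - B) with ((A - u n y) + (u n y - u n t) - (B - u n t)) by ring end.
  apply Rle_lt_trans with (1 := Rabs_triang _ _). rewrite Rabs_Ropp.
  eapply Rle_lt_trans.
  - apply Rplus_le_compat_r. apply Rabs_triang.
  - generalize (Hz n y) (Hz n t) (Hy y Hyt). lra.
Qed.

Lemma is_derive_primitive (f : R -> R) (a t : R) :
  (forall s, continuous f s) -> is_derive (RInt f a) t (f t).
Proof.
  intros Hf. apply (is_derive_RInt f (RInt f a) a t); [|apply Hf].
  apply filter_forall. intros s. apply (RInt_correct (V := R_CompleteNormedModule)).
  apply (ex_RInt_continuous (V := R_CompleteNormedModule)). intros; apply Hf.
Qed.

Lemma is_derive_continuous (f : R -> R) (t l : R) :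
  is_derive f t l -> continuous f t.
Proof.
  intros H. apply (ex_derive_continuous f t). now exists l.
Qed.

Lemma primitive_diff_le (f k : R -> R) (a t h B : R) :
  (forall s, continuous f s) -> (forall s, continuous k s) ->
  Rabs (t - a) <= h ->
  (forall s, Rabs (s - a) <= h -> Rabs (f s - k s) <= B) ->
  Rabs (RInt f a t - RInt k a t) <= h * B.
Proof.
  intros Hf Hk Ht HB.
  assert (HB0 : 0 <= B).
  { apply Rle_trans with (2 := HB t Ht). apply Rabs_pos. }
  apply Rle_trans with (Rabs (t - a) * B).
  2: now apply Rmult_le_compat_r.
  assert (Ef : ex_RInt f a t) by (apply (ex_RInt_continuous (V := R_CompleteNormedModule)); intros; apply Hf).
  assert (Ek : ex_RInt k a t) by (apply (ex_RInt_continuous (V := R_CompleteNormedModule)); intros; apply Hk).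
  apply (norm_RInt_le_const_abs (fun s => minus (f s) (k s)) a t (RInt f a t - RInt k a t) B).
  - intros s Hs. apply HB. revert Hs Ht. unfold Rmin, Rmax.
    destruct Rle_dec; unfold Rabs; repeat destruct Rcase_abs; lra.
  - apply (is_RInt_minus f k a t (RInt f a t) (RInt k a t)); now apply (RInt_correct (V := R_CompleteNormedModule)).
Qed.

(** Picard iteration for [z'' = F s z].  The iterates are frozen outside the
    interval of radius [h], so that the estimates hold on the whole line; a
    Lipschitz constant [L] with [L h ^ 2 <= 1 / 2] makes each step contract by
    one half. *)
Lemma second_order_picard (F : R -> R -> R) (t0 z0 p0 h L B : R) :
  0 < h -> 0 <= L -> L * h ^ 2 <= / 2 ->
  (forall z : R -> R, (forall s, continuous z s) ->
     forall s, continuous (fun s => F s (z s)) s) ->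
  (forall s x y, Rabs (s - t0) <= h -> Rabs (F s x - F s y) <= L * Rabs (x - y)) ->
  (forall s, Rabs (s - t0) <= h -> Rabs (F s z0) <= B) ->
  exists z p : R -> R, z t0 = z0 /\ p t0 = p0 /\
    forall t, Rabs (t - t0) < h ->
      is_derive z t (p t) /\ is_derive p t (F t (z t)).
Proof.
  intros Hh HL HLh HF HLip HB.
  set (c := clamp (t0 - h) (t0 + h)).
  assert (Hc : forall t, Rabs (c t - t0) <= h).
  { intros t. generalize (clamp_bounds (t0 - h) (t0 + h) t ltac:(lra)). fold c.
    unfold Rabs; destruct Rcase_abs; lra. }
  assert (Hcid : forall t, Rabs (t - t0) <= h -> c t = t).
  { intros t Ht. apply clamp_id. revert Ht. unfold Rabs; destruct Rcase_abs; lra. }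
  set (P := fun (z : R -> R) t => p0 + RInt (fun s => F s (z s)) t0 t).
  set (T := fun (z : R -> R) t => z0 + RInt (P z) t0 t).
  assert (HP : forall z, (forall s, continuous z s) ->
    forall t, is_derive (P z) t (F t (z t))).
  { intros z Hz t. unfold P.
    replace (F t (z t)) with (0 + F t (z t)) by ring.
    apply (is_derive_plus (fun _ => p0) (RInt (fun s => F s (z s)) t0)); [exact (is_derive_const p0 t)|].
    apply (is_derive_primitive (fun s => F s (z s))). now apply HF. }
  assert (HPc : forall z, (forall s, continuous z s) -> forall t, continuous (P z) t).
  { intros z Hz t. now apply is_derive_continuous with (1 := HP z Hz t). }
  assert (HT : forall z, (forall s, continuous z s) ->
    forall t, is_derive (T z) t (P z t)).
  { intros z Hz t. unfold T.
    replace (P z t) with (0 + P z t) by ring.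
    apply (is_derive_plus (fun _ => z0) (RInt (P z) t0)); [exact (is_derive_const z0 t)|].
    apply is_derive_primitive. now apply HPc. }
  assert (HTc : forall z, (forall s, continuous z s) -> forall t, continuous (T z) t).
  { intros z Hz t. now apply is_derive_continuous with (1 := HT z Hz t). }
  assert (Hcontr : forall z y d, (forall s, continuous z s) -> (forall s, continuous y s) ->
    (forall s, Rabs (z s - y s) <= d) ->
    forall t, Rabs (T z (c t) - T y (c t)) <= d / 2).
  { intros z y d Hz Hy Hd t.
    assert (Hd0 : 0 <= d) by (apply Rle_trans with (2 := Hd t); apply Rabs_pos).
    apply Rle_trans with (h * (h * (L * d))).
    2: { replace (h * (h * (L * d))) with (L * h ^ 2 * d) by ring.
         replace (d / 2) with (/ 2 * d) by field.
         now apply Rmult_le_compat_r. }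
    unfold T.
    match goal with |- Rabs ?A <= _ =>
      replace A with (RInt (P z) t0 (c t) - RInt (P y) t0 (c t)) by ring end.
    apply primitive_diff_le; auto.
    intros s Hs. unfold P.
    match goal with |- Rabs ?A <= _ =>
      replace A with (RInt (fun s => F s (z s)) t0 s - RInt (fun s => F s (y s)) t0 s) by ring end.
    apply primitive_diff_le; auto.
    intros r Hr. apply Rle_trans with (1 := HLip r _ _ Hr).
    now apply Rmult_le_compat_l. }
  set (u := fix u n := match n with O => fun _ : R => z0 | S k => fun t => T (u k) (c t) end).
  assert (Huc : forall n s, continuous (u n) s).
  { induction n; intros s; simpl.
    - apply continuous_const.
    - apply (continuous_comp c (T (u n))); [apply continuous_clamp|now apply HTc]. }
  set (D := h * (Rabs p0 + h * B)).
  assert (Hu : forall n t, Rabs (u (S n) t - u n t) <= D * (/ 2) ^ n).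
  { induction n; intros t.
    - simpl. unfold T.
      match goal with |- Rabs ?A <= _ =>
        replace A with (RInt (P (fun _ => z0)) t0 (c t) - RInt (fun _ => 0) t0 (c t))
          by (rewrite RInt_const; unfold scal; simpl; unfold mult; simpl; ring) end.
      unfold D. rewrite Rmult_1_r. apply primitive_diff_le; auto.
      + apply HPc. intros; apply continuous_const.
      + intros; apply continuous_const.
      + intros s Hs. unfold P. rewrite Rminus_0_r.
        apply Rle_trans with (1 := Rabs_triang _ _). apply Rplus_le_compat_l.
        match goal with |- Rabs ?A <= _ =>
        replace A with (A - RInt (fun _ => 0) t0 s)
          by (rewrite RInt_const; unfold scal; simpl; unfold mult; simpl; ring) end.
        apply primitive_diff_le; auto.
        * apply (HF (fun _ => z0)). intros; apply continuous_const.
        * intros; apply continuous_const.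
        * intros r Hr. rewrite Rminus_0_r. now apply HB.
    - change (Rabs (T (u (S n)) (c t) - T (u n) (c t)) <= D * (/ 2) ^ S n).
      replace (D * (/ 2) ^ S n) with (D * (/ 2) ^ n / 2) by (simpl; field).
      now apply Hcontr. }
  destruct (geometric_uniform_limit u D Huc Hu) as [z [Hz Hzu]].
  assert (HD : 0 <= D).
  { generalize (Hu O 0) (Rabs_pos (u 1%nat 0 - u O 0)); simpl; lra. }
  assert (Hfix : forall t, z t = T z (c t)).
  { intros t.
    assert (H : forall n, Rabs (T z (c t) - z t) <= 2 * D * (/ 2) ^ n).
    { intros n.
      replace (T z (c t) - z t) with
        ((T z (c t) - T (u n) (c t)) - (z t - u (S n) t)) by (simpl; ring).
      apply Rle_trans with (1 := Rabs_triang _ _). rewrite Rabs_Ropp.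
      generalize (Hcontr z (u n) _ Hz (Huc n) (Hzu n) t) (Hzu (S n) t).
      simpl. lra. }
    generalize (is_lim_seq_le _ _ _ _ H (is_lim_seq_const _) (lim_halves _)). simpl.
    intros H1. generalize (Rabs_pos (T z (c t) - z t)); intros H2.
    destruct (Req_dec (T z (c t) - z t) 0) as [E|E]; [lra|].
    apply Rabs_no_R0 in E. lra. }
  assert (Hct0 : c t0 = t0) by (apply Hcid; rewrite Rminus_diag, Rabs_R0; lra).
  exists z, (P z). split; [|split].
  - rewrite Hfix, Hct0. unfold T. rewrite RInt_point. unfold zero; simpl; ring.
  - unfold P. rewrite RInt_point. unfold zero; simpl; ring.
  - intros t Ht. split; [|now apply HP].
    apply is_derive_ext_loc with (T z); [|now apply HT].
    assert (Hd : 0 < h - Rabs (t - t0)) by lra.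
    exists (mkposreal _ Hd). intros s Hs.
    change (Rabs (s - t) < h - Rabs (t - t0)) in Hs.
    rewrite (Hfix s), Hcid; [reflexivity|].
    replace (s - t0) with ((s - t) + (t - t0)) by ring.
    generalize (Rabs_triang (s - t) (t - t0)). lra.
Qed.

Lemma pow_Lipschitz (m : nat) (K : R) : 0 <= K ->
  exists L, 0 <= L /\ forall x y, Rabs x <= K -> Rabs y <= K ->
    Rabs (x ^ m - y ^ m) <= L * Rabs (x - y).
Proof.
  intros HK. induction m as [|m [L [HL IH]]].
  - exists 0. split; [lra|]. intros. simpl. rewrite Rminus_diag, Rabs_R0. lra.
  - exists (K * L + K ^ m). split.
    + generalize (pow_le K m HK). nra.
    + intros x y Hx Hy. simpl.
      replace (x * x ^ m - y * y ^ m) with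
        (x * (x ^ m - y ^ m) + (x - y) * y ^ m) by ring.
      apply Rle_trans with (1 := Rabs_triang _ _). rewrite !Rabs_mult.
      rewrite Rmult_plus_distr_r. apply Rplus_le_compat.
      * rewrite Rmult_assoc. apply Rmult_le_compat; auto using Rabs_pos.
      * rewrite Rmult_comm. apply Rmult_le_compat_r; [apply Rabs_pos|].
        rewrite <- RPow_abs. apply pow_incr. split; [apply Rabs_pos|exact Hy].
Qed.

Lemma continuous_pow (m : nat) (x : R) : continuous (fun y => y ^ m) x.
Proof.
  apply (ex_derive_continuous (fun y => y ^ m) x). auto_derive. exact I.
Qed.

(** The force is truncated at [|z| = |z0| + 1] to make it Lipschitz; the
    solution of the truncated equation stays below that level for a short
    time, during which it solves the original one. *)
Lemma local_solution (omega : R) (m : nat) (g : R -> R) (t0 z0 p0 : R) :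
  (forall t, continuous g t) ->
  exists (d : R) (z : R -> R), 0 < d /\
    is_solution omega m g (t0 - d) (t0 + d) z /\ z t0 = z0 /\
    is_derive z t0 p0.
Proof.
  intros Hg.
  set (K := Rabs z0 + 1).
  assert (HK : 0 < K) by (unfold K; generalize (Rabs_pos z0); lra).
  destruct (pow_Lipschitz m K ltac:(lra)) as [Lm [HLm HLip]].
  destruct (continuity_ab_maj (fun t => Rabs (g t)) (t0 - 1) (t0 + 1)) as [tM [HM _]].
  { lra. }
  { intros s _. apply continuity_pt_filterlim. apply (continuous_comp g Rabs); [apply Hg|].
    apply continuous_Rabs. }
  set (G := Rabs (g tM)) in HM.
  set (k := clamp (- K) K).
  assert (Hk : forall x, Rabs (k x) <= K).
  { intros x. generalize (clamp_bounds (- K) K x ltac:(lra)). fold k.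
    unfold Rabs; destruct Rcase_abs; lra. }
  set (F := fun s x => - (omega ^ 2 * k x + g s * k x ^ m)).
  set (L := omega ^ 2 + G * Lm).
  assert (HG : 0 <= G) by apply Rabs_pos.
  assert (HL : 0 <= L) by (unfold L; generalize (pow2_ge_0 omega); nra).
  set (h := / (2 * (L + 1))).
  assert (Hh : 0 < h) by (apply Rinv_0_lt_compat; lra).
  assert (Hh1 : h <= 1 /\ L * h ^ 2 <= / 2).
  { assert (E : h * (2 * (L + 1)) = 1) by (unfold h; field; lra). split; nra. }
  destruct Hh1 as [Hh1 HLh].
  assert (HgG : forall s, Rabs (s - t0) <= h -> Rabs (g s) <= G).
  { intros s Hs. apply HM. revert Hs. unfold Rabs; destruct Rcase_abs; lra. }
  destruct (second_order_picard F t0 z0 p0 h L (omega ^ 2 * K + G * K ^ m))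
    as [z [p [Hz0 [Hp0 Hzp]]]]; auto.
  - intros z Hz s. unfold F.
    assert (Hkz : continuous (fun s => k (z s)) s).
    { apply (continuous_comp z k); [apply Hz|apply continuous_clamp]. }
    apply (continuous_opp (fun s => omega ^ 2 * k (z s) + g s * k (z s) ^ m)).
    apply (continuous_plus (fun s => omega ^ 2 * k (z s)) (fun s => g s * k (z s) ^ m)).
    + apply (continuous_mult (fun _ => omega ^ 2) (fun s => k (z s))); [apply continuous_const|exact Hkz].
    + apply (continuous_mult g (fun s => k (z s) ^ m)); [apply Hg|].
      apply (continuous_comp (fun s => k (z s)) (fun y => y ^ m)); [exact Hkz|apply continuous_pow].
  - intros s x y Hs. unfold F.
    match goal with |- Rabs ?A <= _ => replace A with
      (omega ^ 2 * (k y - k x) + g s * (k y ^ m - k x ^ m)) by ring end.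
    apply Rle_trans with (1 := Rabs_triang _ _). rewrite !Rabs_mult.
    generalize (clamp_contract (- K) K x y) (HLip (k y) (k x) (Hk y) (Hk x)). fold k.
    rewrite (Rabs_minus_sym y x), (Rabs_pos_eq (omega ^ 2)) by apply pow2_ge_0.
    intros H1 H2. unfold L. rewrite Rmult_plus_distr_r.
    apply Rplus_le_compat.
    + apply Rmult_le_compat_l; [apply pow2_ge_0|exact H1].
    + rewrite Rmult_assoc.
      apply Rmult_le_compat; auto using Rabs_pos.
      apply Rle_trans with (1 := H2). now apply Rmult_le_compat_l.
  - intros s Hs. unfold F. rewrite Rabs_Ropp.
    apply Rle_trans with (1 := Rabs_triang _ _). rewrite !Rabs_mult.
    rewrite (Rabs_pos_eq (omega ^ 2)) by apply pow2_ge_0.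
    apply Rplus_le_compat.
    + apply Rmult_le_compat_l; [apply pow2_ge_0|apply Hk].
    + apply Rmult_le_compat; auto using Rabs_pos.
      rewrite <- RPow_abs. apply pow_incr. split; [apply Rabs_pos|apply Hk].
  - assert (Ht0 : Rabs (t0 - t0) < h) by (rewrite Rminus_diag, Rabs_R0; exact Hh).
    destruct (continuous_abs_elim z t0 1) as [d [Hd Hzd]].
    { apply is_derive_continuous with (p t0). apply Hzp, Ht0. }
    { lra. }
    exists (Rmin d h), z. split; [now apply Rmin_pos|].
    split; [|split; [exact Hz0|]].
    2: { rewrite <- Hp0. apply Hzp, Ht0. }
    intros t Hta Htb. simpl in Hta, Htb.
    assert (Ht : Rabs (t - t0) < Rmin d h).
    { unfold Rabs; destruct Rcase_abs; lra. }
    assert (Htd : Rabs (t - t0) < d) by (apply Rlt_le_trans with (1 := Ht), Rmin_l).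
    assert (Hth : Rabs (t - t0) < h) by (apply Rlt_le_trans with (1 := Ht), Rmin_r).
    destruct (Hzp t Hth) as [Hz Hp].
    assert (Hz2 : is_derive (Derive z) t (F t (z t))).
    { apply is_derive_ext_loc with p; [|exact Hp].
      exists (mkposreal (h - Rabs (t - t0)) ltac:(lra)). intros s Hs.
      change (Rabs (s - t) < h - Rabs (t - t0)) in Hs.
      symmetry. apply is_derive_unique. apply Hzp.
      replace (s - t0) with ((s - t) + (t - t0)) by ring.
      generalize (Rabs_triang (s - t) (t - t0)). lra. }
    split; [now exists (p t)|]. split; [now exists (F t (z t))|].
    change (Derive_n z 2 t) with (Derive (Derive z) t).
    rewrite (is_derive_unique _ _ _ Hz2). unfold F.
    assert (Hkz : k (z t) = z t).
    { apply clamp_id. specialize (Hzd t Htd). rewrite Hz0 in Hzd. revert Hzd.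
      unfold K, Rabs; repeat destruct Rcase_abs; lra. }
    rewrite Hkz. ring.
Qed.

(** * Determining equations of a quadratic invariant *)

Lemma C1_2d_along (f : R -> R -> R) (z : R -> R) (t p : R) :
  C1_2d f -> is_derive z t p ->
  is_derive (fun s => f (z s) s) t
    (Derive (fun y => f y t) (z t) * p + Derive (fun s => f (z t) s) t).
Proof.
  intros Hf Hz.
  rewrite <- (Rmult_1_r (Derive (fun s => f (z t) s) t)).
  apply is_derive_Reals.
  apply (derivable_pt_lim_comp_2d f z (fun s => s)).
  2: now apply is_derive_Reals.
  2: apply derivable_pt_lim_id.
  apply filterdiff_differentiable_pt_lim.
  apply (is_derive_filterdiff f (z t) t
    (fun y s => Derive (fun y' => f y' s) y) (Derive (fun s => f (z t) s) t)).
  - apply filter_forall. intros u.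
    destruct (Hf (fst u) (snd u)) as (H & _). exact (Derive_correct _ _ H).
  - destruct (Hf (z t) t) as (_ & H & _). exact (Derive_correct _ _ H).
  - destruct (Hf (z t) t) as (_ & _ & H & _).
    now apply (continuity_2d_pt_filterlim (fun y s => Derive (fun y' => f y' s) y)).
Qed.

Lemma is_derive_quadratic (A0 A1 A2 Z : R -> R) (t l0 l1 l2 l : R) :
  is_derive A0 t l0 -> is_derive A1 t l1 -> is_derive A2 t l2 -> is_derive Z t l ->
  is_derive (fun s => A0 s + A1 s * Z s + A2 s * Z s ^ 2) t
    (l0 + (l1 * Z t + A1 t * l) + (l2 * Z t ^ 2 + 2 * A2 t * Z t * l)).
Proof. intros H0 H1 H2 H. derive_by (simpl; ring). Qed.

(** Along a solution the derivative of the invariant is a cubic polynomial in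
    the velocity; solutions exist with every initial velocity, so each
    coefficient vanishes. *)
Lemma determining_equations (omega : R) (m : nat) (g : R -> R)
    (a0 a1 a2 : R -> R -> R) :
  (forall t, continuous g t) ->
  is_quadratic_invariant omega m g a0 a1 a2 ->
  forall x t,
    Derive (fun y => a2 y t) x = 0 /\
    Derive (fun y => a1 y t) x + Derive (fun s => a2 x s) t = 0 /\
    Derive (fun y => a0 y t) x + Derive (fun s => a1 x s) t
      = 2 * a2 x t * (omega ^ 2 * x + g t * x ^ m) /\
    Derive (fun s => a0 x s) t = a1 x t * (omega ^ 2 * x + g t * x ^ m).
Proof.
  intros Hg (C0 & C1 & C2 & _ & Hinv) x t.
  set (F := omega ^ 2 * x + g t * x ^ m).
  assert (Hp : forall p,
    (Derive (fun s => a0 x s) t - a1 x t * F)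
    + (Derive (fun y => a0 y t) x + Derive (fun s => a1 x s) t - 2 * a2 x t * F) * p
    + (Derive (fun y => a1 y t) x + Derive (fun s => a2 x s) t) * p ^ 2
    + Derive (fun y => a2 y t) x * p ^ 3 = 0).
  { intros p.
    destruct (local_solution omega m g t x p Hg) as (d & z & Hd & Hsol & Hz0 & Hz1).
    assert (Ha : Rbar_lt (t - d) t) by (simpl; lra).
    assert (Hb : Rbar_lt t (t + d)) by (simpl; lra).
    destruct (Hsol t Ha Hb) as (_ & E2 & Hode).
    assert (Hz2 : is_derive (Derive z) t (- F)).
    { replace (- F) with (Derive (Derive z) t).
      - now apply Derive_correct.
      - change (Derive (Derive z) t) with (Derive_n z 2 t).
        unfold F. rewrite Hz0 in Hode. lra. }
    assert (Hp : Derive z t = p) by now apply is_derive_unique.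
    generalize (is_derive_unique _ _ _ (Hinv _ _ z Hsol t Ha Hb)).
    generalize (C1_2d_along a0 z t p C0 Hz1) (C1_2d_along a1 z t p C1 Hz1)
      (C1_2d_along a2 z t p C2 Hz1).
    intros D0 D1 D2.
    rewrite (is_derive_unique _ _ _
      (is_derive_quadratic _ _ _ _ _ _ _ _ _ D0 D1 D2 Hz2)), Hz0, Hp.
    intros <-. ring. }
  generalize (Hp 0) (Hp 1) (Hp (-1)) (Hp 2). intros H0 H1 H2 H3.
  repeat split; lra.
Qed.

Lemma derive_eq_poly (f : R -> R) (c0 c1 c2 k : R) (m : nat) :
  f 0 = c0 ->
  (forall x, is_derive f x (c1 + 2 * c2 * x + INR (S m) * k * x ^ m)) ->
  forall x, f x = c0 + c1 * x + c2 * x ^ 2 + k * x ^ S m.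
Proof.
  intros H0 Hf x.
  assert (H : forall y, is_derive
    (fun y => f y - (c1 * y + c2 * y ^ 2 + k * y ^ S m)) y 0).
  { intros y. generalize (Hf y); intros Hy.
    assert (Hpoly : is_derive (fun y => c1 * y + c2 * y ^ 2 + k * y ^ S m) y
      (c1 + 2 * c2 * y + INR (S m) * k * y ^ m)).
    { auto_derive; [exact I|]. change (match m with O => 1 | S _ => INR m + 1 end) with (INR (S m)).
      simpl pred. simpl (INR 2). simpl (y ^ 1). ring. }
    generalize (is_derive_minus _ _ _ _ _ Hy Hpoly).
    now rewrite minus_eq_zero. }
  generalize (derive_zero_const _ H x 0). rewrite H0.
  replace (c2 * 0 ^ 2) with 0 by ring. replace (k * 0 ^ S m) with 0 by (simpl; ring).
  lra.
Qed.

(** Values at four consecutive powers of two form a Vandermonde system for the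
    nodes [2], [4], [u], [2 * u]. *)
Lemma vandermonde4 (u c1 c2 c3 c4 : R) : 8 <= u ->
  c1 + c2 + c3 + c4 = 0 ->
  c1 * 2 + c2 * 4 + c3 * u + c4 * (2 * u) = 0 ->
  c1 * 2 ^ 2 + c2 * 4 ^ 2 + c3 * u ^ 2 + c4 * (2 * u) ^ 2 = 0 ->
  c1 * 2 ^ 3 + c2 * 4 ^ 3 + c3 * u ^ 3 + c4 * (2 * u) ^ 3 = 0 ->
  c1 = 0 /\ c2 = 0 /\ c3 = 0 /\ c4 = 0.
Proof.
  intros Hu E0 E1 E2 E3.
  assert (H4 : c4 * ((2 * u - 2) * (2 * u - 4) * u) = 0).
  { transitivity ((c1 * 2 ^ 3 + c2 * 4 ^ 3 + c3 * u ^ 3 + c4 * (2 * u) ^ 3)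
      - (6 + u) * (c1 * 2 ^ 2 + c2 * 4 ^ 2 + c3 * u ^ 2 + c4 * (2 * u) ^ 2)
      + (8 + 6 * u) * (c1 * 2 + c2 * 4 + c3 * u + c4 * (2 * u))
      - 8 * u * (c1 + c2 + c3 + c4)); [ring|rewrite E0, E1, E2, E3; ring]. }
  apply Rmult_integral in H4. destruct H4 as [H4|H4].
  2: { exfalso. revert H4. apply Rgt_not_eq.
       apply Rmult_lt_0_compat; [apply Rmult_lt_0_compat|]; lra. }
  subst c4.
  assert (H3 : c3 * ((u - 2) * (u - 4)) = 0).
  { transitivity ((c1 * 2 ^ 2 + c2 * 4 ^ 2 + c3 * u ^ 2 + 0 * (2 * u) ^ 2)
      - 6 * (c1 * 2 + c2 * 4 + c3 * u + 0 * (2 * u))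
      + 8 * (c1 + c2 + c3 + 0)); [ring|rewrite E0, E1, E2; ring]. }
  apply Rmult_integral in H3. destruct H3 as [H3|H3].
  2: { exfalso. revert H3. apply Rgt_not_eq. apply Rmult_lt_0_compat; lra. }
  subst c3. lra.
Qed.

Lemma pow2_ge_8 (m : nat) : (3 <= m)%nat -> 8 <= 2 ^ m.
Proof.
  intros H. replace m with (3 + (m - 3))%nat by lia. rewrite pow_add.
  assert (1 <= 2 ^ (m - 3)) by (apply pow_R1_Rle; lra). simpl; lra.
Qed.

Lemma coefficients_vanish (m : nat) (c1 c2 c3 c4 : R) : (3 <= m)%nat ->
  (forall x, c1 * x + c2 * x ^ 2 + c3 * x ^ m + c4 * x ^ S m = 0) ->
  c1 = 0 /\ c2 = 0 /\ c3 = 0 /\ c4 = 0.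
Proof.
  intros Hm H.
  assert (H2 : forall j, (2 ^ j) ^ m = (2 ^ m) ^ j).
  { intros j. rewrite <- !pow_mult. f_equal. lia. }
  apply (vandermonde4 (2 ^ m)); [now apply pow2_ge_8| | | |].
  - generalize (H 1). rewrite !pow1. lra.
  - generalize (H 2). simpl. lra.
  - generalize (H (2 ^ 2)). rewrite <- (tech_pow_Rmult _ m), H2. intros <-. ring.
  - generalize (H (2 ^ 3)). rewrite <- (tech_pow_Rmult _ m), H2. intros <-. ring.
Qed.

Lemma ex_derive_combination (f1 f2 f3 f4 f : R -> R) (k1 k2 k3 k4 t : R) :
  ex_derive f1 t -> ex_derive f2 t -> ex_derive f3 t -> ex_derive f4 t ->
  (forall s, k1 * f1 s + k2 * f2 s + k3 * f3 s + k4 * f4 s = f s) ->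
  ex_derive f t.
Proof.
  intros [l1 H1] [l2 H2] [l3 H3] [l4 H4] E.
  apply (ex_derive_eq _ f t E). exists (k1 * l1 + k2 * l2 + k3 * l3 + k4 * l4).
  derive_by ring.
Qed.

(** A time-dependent polynomial in [1, x, x ^ 2, x ^ n] that is differentiable
    in time for every [x] has differentiable coefficients: they are fixed
    linear combinations of its values at [0, 1, 2, 4]. *)
Lemma coefficients_differentiable (n : nat) (c0 c1 c2 c3 : R -> R) (t : R) :
  (3 <= n)%nat ->
  (forall x, ex_derive (fun s => c0 s + c1 s * x + c2 s * x ^ 2 + c3 s * x ^ n) t) ->
  ex_derive c0 t /\ ex_derive c1 t /\ ex_derive c2 t /\ ex_derive c3 t.
Proof.
  intros Hn H.
  set (phi := fun x s => c0 s + c1 s * x + c2 s * x ^ 2 + c3 s * x ^ n).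
  assert (Hphi : forall x, ex_derive (phi x) t) by exact H.
  assert (H0 : ex_derive c0 t).
  { apply (ex_derive_eq (phi 0)); [|apply Hphi]. intros s. unfold phi.
    rewrite !pow_i by lia. ring. }
  generalize (pow2_ge_8 n Hn). set (u := 2 ^ n). intros Hu.
  assert (H4 : 4 ^ n = u ^ 2).
  { unfold u. replace 4 with (2 ^ 2) by ring. rewrite <- !pow_mult. f_equal. lia. }
  assert (Hu0 : (u - 2) * (u - 4) <> 0).
  { apply Rgt_not_eq, Rmult_lt_0_compat; lra. }
  assert (H3 : ex_derive c3 t).
  { apply (ex_derive_combination (phi 4) (phi 2) (phi 1) c0 c3
      (/ ((u - 2) * (u - 4))) (- 6 / ((u - 2) * (u - 4)))
      (8 / ((u - 2) * (u - 4))) (- 3 / ((u - 2) * (u - 4)))); auto.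
    intros s. unfold phi. rewrite !pow1, H4. fold u. field. lra. }
  assert (H2 : ex_derive c2 t).
  { apply (ex_derive_combination (phi 2) (phi 1) c0 c3 c2
      (/ 2) (-1) (/ 2) (- (u - 2) / 2)); auto.
    intros s. unfold phi. rewrite !pow1. fold u. field. }
  assert (H1 : ex_derive c1 t).
  { apply (ex_derive_combination (phi 1) c0 c2 c3 c1 1 (-1) (-1) (-1)); auto.
    intros s. unfold phi. rewrite !pow1. ring. }
  auto.
Qed.

(** The determining equations integrate in [x] to [a2 = al], [a1 = be - al' x] and
    [a0 = ga - be' x + (al'' / 2 + omega ^ 2 al) x ^ 2
    + 2 / (m + 1) al g x ^ (m + 1)].  The [C1] assumption then makes the
    coefficients of [a0] differentiable in time, which provides [be''], [al''']
    and the derivative of [al g].  Comparing powers of [x] in the last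
    determining equation, where [x ^ m] meets [x ^ 2] only for [m = 2], leaves the
    forcing term [2 be g]; for [m > 2] the power [x ^ m] stands alone and forces
    [be = 0]. *)
Lemma invariant_structure (omega : R) (m : nat) (g : R -> R)
    (a0 a1 a2 : R -> R -> R) :
  (2 <= m)%nat -> (forall t, continuous g t) -> (forall t, g t <> 0) ->
  is_quadratic_invariant omega m g a0 a1 a2 ->
  exists al al1 al2 al3 be be1 : R -> R,
    (exists t, al t <> 0) /\ 
    (forall t, is_derive al t (al1 t)) /\ 
    (forall t, is_derive al1 t (al2 t)) /\ 
    (forall t, is_derive al2 t (al3 t)) /\ 
    (forall t, is_derive be t (be1 t)) /\ 
    (forall t, is_derive be1 t (- omega ^ 2 * be t)) /\ 
    (forall t, is_derive (fun s => al s * g s) t (- (INR m + 1) / 2 * al1 t * g t)) /\ 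
    (forall t, al3 t + 4 * omega ^ 2 * al1 t = 2 * be t * g t) /\ 
    (m <> 2%nat -> forall t, be t = 0).
Proof.
  intros Hm Hg Hg0 Hinv.
  pose proof (determining_equations omega m g a0 a1 a2 Hg Hinv) as Hdet.
  destruct Hinv as (C0 & C1 & C2 & (x0 & t0 & Hne) & _).
  set (al := fun t => a2 0 t). set (be := fun t => a1 0 t). set (ga := fun t => a0 0 t).
  assert (Ea2 : forall x t, a2 x t = al t).
  { intros x t. apply (derive_zero_const (fun y => a2 y t)). intros y.
    destruct (Hdet y t) as (<- & _). apply Derive_correct. now destruct (C2 y t). }
  set (al1 := Derive al).
  assert (Dal : forall t, is_derive al t (al1 t)).
  { intros t. apply Derive_correct. now destruct (C2 0 t) as (_ & ? & _). }
  set (be1 := Derive be).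
  assert (Dbe : forall t, is_derive be t (be1 t)).
  { intros t. apply Derive_correct. now destruct (C1 0 t) as (_ & ? & _). }
  assert (Da2t : forall x t, Derive (fun s => a2 x s) t = al1 t).
  { intros x t. apply Derive_ext. intros s. apply Ea2. }
  assert (Ea1 : forall x t, a1 x t = be t - al1 t * x).
  { intros x t.
    enough (a1 x t + al1 t * x = be t + al1 t * 0) by lra.
    apply (derive_zero_const (fun y => a1 y t + al1 t * y)). intros y.
    destruct (Hdet y t) as (_ & H1 & _). rewrite Da2t in H1.
    assert (Hlin : forall (f : R -> R) (k : R), ex_derive f y ->
      is_derive (fun y => f y + k * y) y (Derive f y + k)).
    { intros f k Hf. auto_derive; [easy|]. change (Derive (fun x => f x) y) with (Derive f y). ring. }
    rewrite <- H1. apply (Hlin (fun y => a1 y t)). now destruct (C1 y t). }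
  set (al2 := Derive al1).
  assert (Dal1 : forall t, is_derive al1 t (al2 t)).
  { intros t. apply Derive_correct.
    destruct (C1 0 t) as (_ & H0 & _). destruct (C1 1 t) as (_ & H1 & _).
    apply (ex_derive_combination _ _ _ _ al1 1 (-1) 0 0 t H0 H1 H0 H0).
    intros s. rewrite !Ea1. ring. }
  assert (Da1t : forall x t, Derive (fun s => a1 x s) t = be1 t - al2 t * x).
  { intros x t. apply is_derive_unique.
    apply (is_derive_eq (fun s => be s - al1 s * x)); [intros s; now rewrite Ea1|].
    generalize (Dbe t) (Dal1 t); intros H1 H2. derive_by ring. }
  set (q2 := fun t => al2 t / 2 + omega ^ 2 * al t).
  set (q3 := fun t => 2 / (INR m + 1) * (al t * g t)).
  assert (Hm1 : INR m + 1 <> 0) by (generalize (pos_INR m); lra).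
  assert (Ea0 : forall x t,
    a0 x t = ga t + - be1 t * x + q2 t * x ^ 2 + q3 t * x ^ S m).
  { intros x t. apply (derive_eq_poly (fun y => a0 y t)); [reflexivity|].
    intros y. destruct (Hdet y t) as (_ & _ & H1 & _). rewrite Da1t, Ea2 in H1.
    match goal with |- is_derive _ _ ?l =>
      replace l with (Derive (fun y => a0 y t) y) end.
    - apply Derive_correct. now destruct (C0 y t).
    - unfold q2, q3. rewrite S_INR.
      apply (Rplus_eq_reg_r (be1 t - al2 t * y)). rewrite H1. now field. }
  assert (Hcoef : forall t, ex_derive ga t /\ ex_derive (fun s => - be1 s) t /\
    ex_derive q2 t /\ ex_derive q3 t).
  { intros t. apply (coefficients_differentiable (S m)); [lia|].
    intros x. apply (ex_derive_eq (fun s => a0 x s)); [intros s; apply Ea0|].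
    now destruct (C0 x t) as (_ & ? & _). }
  set (be2 := Derive be1). set (q2' := Derive q2). set (q3' := Derive q3).
  set (ga' := Derive ga).
  assert (Dga : forall t, is_derive ga t (ga' t)) by (intros t; apply Derive_correct, Hcoef).
  assert (Dbe1 : forall t, is_derive be1 t (be2 t)).
  { intros t. apply Derive_correct.
    destruct (Hcoef t) as (_ & H & _).
    apply (ex_derive_combination _ _ _ _ be1 (-1) 0 0 0 t H H H H).
    intros s. ring. }
  assert (Dq2 : forall t, is_derive q2 t (q2' t)) by (intros t; apply Derive_correct, Hcoef).
  assert (Dq3 : forall t, is_derive q3 t (q3' t)) by (intros t; apply Derive_correct, Hcoef).
  assert (Hpoly : forall x t,
    ga' t + - be2 t * x + q2' t * x ^ 2 + q3' t * x ^ S m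
    = (be t - al1 t * x) * (omega ^ 2 * x + g t * x ^ m)).
  { intros x t. destruct (Hdet x t) as (_ & _ & _ & H). rewrite Ea1 in H. rewrite <- H.
    symmetry. apply is_derive_unique.
    apply (is_derive_eq (fun s => ga s + - be1 s * x + q2 s * x ^ 2 + q3 s * x ^ S m));
      [intros s; now rewrite Ea0|].
    generalize (Dga t) (Dbe1 t) (Dq2 t) (Dq3 t); intros H1 H2 H3 H4.
    generalize (x ^ S m); intros y. derive_by ring. }
  assert (Hga : forall t, ga' t = 0).
  { intros t. generalize (Hpoly 0 t). rewrite !pow_i by lia. lra. }
  assert (Hsol : forall t, be2 t = - omega ^ 2 * be t /\ q3' t = - al1 t * g t /\
    q2' t = - omega ^ 2 * al1 t + be t * g t /\ (m <> 2%nat -> be t = 0)).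
  { intros t.
    assert (H : forall x, (- be2 t - omega ^ 2 * be t) * x
      + (q2' t + omega ^ 2 * al1 t) * x ^ 2 + (- be t * g t) * x ^ m
      + (q3' t + al1 t * g t) * x ^ S m = 0).
    { intros x. generalize (Hpoly x t). rewrite Hga. simpl (x ^ S m). lra. }
    destruct (Nat.eq_dec m 2) as [->|Hm2].
    - generalize (H 1) (H (-1)) (H 2). simpl. intros. repeat split; lra || easy.
    - destruct (coefficients_vanish m _ _ _ _ ltac:(lia) H) as (H1 & H2 & H3 & H4).
      assert (Hb : be t = 0).
      { apply Rmult_integral in H3. destruct H3 as [H3|H3]; [lra|now apply Hg0 in H3]. }
      rewrite Hb in H1 |- *. repeat split; lra. }
  set (al3 := fun t => 2 * q2' t - 2 * omega ^ 2 * al1 t).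
  exists al, al1, al2, al3, be, be1.
  split; [exists t0; now rewrite <- (Ea2 x0)|].
  refine (conj Dal (conj Dal1 (conj _ (conj Dbe (conj _ (conj _ (conj _ _))))))).
  - intros t. apply (is_derive_eq (fun s => 2 * q2 s - 2 * omega ^ 2 * al s)).
    { intros s. unfold q2. field. }
    generalize (Dq2 t) (Dal t); intros H1 H2. unfold al3.
    clearbody q2 al. derive_by ring.
  - intros t. destruct (Hsol t) as (<- & _). apply Dbe1.
  - intros t. apply (is_derive_eq (fun s => (INR m + 1) / 2 * q3 s)).
    { intros s. unfold q3. now field. }
    destruct (Hsol t) as (_ & H & _).
    replace (- (INR m + 1) / 2 * al1 t * g t) with ((INR m + 1) / 2 * q3' t)
      by (rewrite H; field).
    now apply (is_derive_scal q3).
  - intros t. destruct (Hsol t) as (_ & _ & H & _). unfold al3. rewrite H. ring.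
  - intros H t. now apply Hsol.
Qed.

(** * The leading coefficient as a power of g *)

Lemma constant_sign (f : R -> R) :
  (forall t, continuous f t) -> (forall t, f t <> 0) ->
  exists e : R, e * e = 1 /\ forall t, f t = e * Rabs (f t).
Proof.
  intros Hc Hne.
  assert (Hs : forall t, ~ (Rmin (f 0) (f t) <= 0 <= Rmax (f 0) (f t))).
  { intros t H. destruct (IVT_gen f 0 t 0) as [x [_ Hx]]; [|exact H|exact (Hne x Hx)].
    intros s. apply continuity_pt_filterlim, Hc. }
  destruct (Rdichotomy _ _ (Hne 0)) as [H0|H0].
  - exists (-1). split; [lra|]. intros t. specialize (Hs t). revert Hs.
    unfold Rmin, Rmax. repeat destruct Rle_dec; unfold Rabs; destruct Rcase_abs; lra.
  - exists 1. split; [lra|]. intros t. specialize (Hs t). revert Hs.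
    unfold Rmin, Rmax. repeat destruct Rle_dec; unfold Rabs; destruct Rcase_abs; lra.
Qed.

Lemma Rpower_pos (x y : R) : 0 < Rpower x y.
Proof. apply exp_pos. Qed.

Lemma Rpower_alpha2 (m : nat) (g : R -> R) (t : R) : g t <> 0 ->
  Rabs (g t) = Rpower (alpha2 m g t) (- (INR m + 3) / 2).
Proof.
  intros Hg. unfold alpha2. rewrite Rpower_mult.
  replace (_ * _) with 1 by (field; generalize (pos_INR m); lra).
  now rewrite Rpower_1 by now apply Rabs_pos_lt.
Qed.

Lemma alpha2_Rpower (m : nat) (g : R -> R) (t x : R) : 0 < x ->
  Rabs (g t) = Rpower x (- (INR m + 3) / 2) -> alpha2 m g t = x.
Proof.
  intros Hx Hg. unfold alpha2. rewrite Hg, Rpower_mult.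
  replace (_ * _) with 1 by (field; generalize (pos_INR m); lra).
  now apply Rpower_1.
Qed.

(** The hypothesis on [al * g] makes [g ^ 2 * al ^ (m + 3)] constant.  Since [g]
    is not known to be differentiable, this constant is differentiated in the
    form [(al * g) ^ 2 * al ^ (m + 1)].  It also shows that [al] never vanishes. *)
Lemma proportional_to_alpha2 (m : nat) (g al al1 : R -> R) :
  (forall t, g t <> 0) -> (exists t : R, al t <> 0) ->
  (forall t, is_derive al t (al1 t)) ->
  (forall t, is_derive (fun s => al s * g s) t (- (INR m + 1) / 2 * al1 t * g t)) ->
  exists c : R, c <> 0 /\ forall t, al t = c * alpha2 m g t.
Proof.
  intros Hg [t0 Ht0] Dal Dh.
  set (h := fun s => al s * g s).
  assert (HN : forall s t, h s ^ 2 * al s ^ S m = h t ^ 2 * al t ^ S m).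
  { intros s t. apply (derive_zero_const (fun s => h s ^ 2 * al s ^ S m)). clear s t.
    intros t. generalize (Dal t). generalize (Dh t : is_derive h t _).
    assert (E : h t = al t * g t) by reflexivity. revert E. generalize (al1 t) as l.
    generalize h as k. intros k l E H1 H2.
    derive_by idtac. rewrite E.
    change (match m with O => 1 | S _ => INR m + 1 end) with (INR (S m)).
    rewrite S_INR. simpl. field. }
  set (N := h t0 ^ 2 * al t0 ^ S m) in *.
  assert (HN0 : N <> 0).
  { unfold N, h. apply Rmult_integral_contrapositive_currified; apply pow_nonzero; auto. }
  assert (Hal : forall t, al t <> 0).
  { intros t E. apply HN0. unfold N. rewrite (HN t0 t), E, (pow_i (S m)) by lia. ring. }
  destruct (constant_sign al) as [e [He Hsgn]]; auto.
  { intros t. now apply is_derive_continuous with (al1 t). }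
  exists (e * exp (ln (Rabs N) / (INR m + 3))). split.
  { apply Rmult_integral_contrapositive_currified; [nra|].
    apply Rgt_not_eq, exp_pos. }
  intros t. rewrite (Hsgn t), Rmult_assoc. f_equal.
  unfold alpha2, Rpower. rewrite <- exp_plus.
  assert (Hx : 0 < Rabs (al t)) by apply Rabs_pos_lt, Hal.
  assert (Hy : 0 < Rabs (g t)) by apply Rabs_pos_lt, Hg.
  rewrite <- (exp_ln _ Hx) at 1. f_equal.
  assert (HlnN : ln (Rabs N) = 2 * ln (Rabs (g t)) + (INR m + 3) * ln (Rabs (al t))).
  { unfold N. rewrite (HN t0 t). unfold h.
    replace ((al t * g t) ^ 2 * al t ^ S m) with (g t ^ 2 * al t ^ (m + 3))
      by (replace (m + 3)%nat with (2 + S m)%nat by lia; rewrite pow_add; ring).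
    rewrite Rabs_mult, <- !RPow_abs, ln_mult, !ln_pow by auto using pow_lt.
    rewrite plus_INR. simpl. ring. }
  rewrite HlnN. field. generalize (pos_INR m); lra.
Qed.

(** * Absence of periodic resonance *)

(** A nondecreasing periodic function is constant on each period. *)
Lemma periodic_monotone (G G1 : R -> R) (T : R) : 0 < T ->
  (forall t, G (t + T) = G t) -> (forall t, is_derive G t (G1 t)) ->
  (forall t, 0 <= G1 t) -> forall t, G1 t = 0.
Proof.
  intros HT Hper HG Hpos.
  assert (Hmono : forall s t, s <= t -> G s <= G t).
  { intros s t Hst.
    destruct (MVT_gen G s t G1) as [c [_ Hc]].
    - intros; apply HG.
    - intros x _. apply continuity_pt_filterlim.
      apply (ex_derive_continuous G x). now exists (G1 x).
    - generalize (Hpos c). nra. }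
  intros t0.
  assert (Hc : forall t, t0 <= t <= t0 + T -> G t = G t0).
  { intros t Ht. apply Rle_antisym.
    - rewrite <- (Hper t0). apply Hmono; lra.
    - apply Hmono; lra. }
  destruct (Rle_lt_or_eq_dec _ _ (Hpos t0)) as [H|H]; [|now symmetry].
  exfalso. generalize (HG t0); intros Hd. apply is_derive_Reals in Hd.
  destruct (Hd (G1 t0) H) as [d Hdd].
  assert (Hd0 := cond_pos d).
  set (h := Rmin (d / 2) T).
  assert (Hh : 0 < h) by (apply Rmin_pos; lra).
  assert (h <= d / 2) by apply Rmin_l. assert (h <= T) by apply Rmin_r.
  specialize (Hdd h). rewrite (Hc (t0 + h)) in Hdd by lra.
  replace ((G t0 - G t0) / h - G1 t0) with (- G1 t0) in Hdd by (field; lra).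
  rewrite Rabs_Ropp, (Rabs_pos_eq (G1 t0)), (Rabs_pos_eq h) in Hdd by lra.
  assert (G1 t0 < G1 t0) by (apply Hdd; lra). lra.
Qed.

(** In the time [s] with [ds = q dt] the hypotheses say that [M] moves in a cubic
    potential, [M_ss = - M ^ 2 / 2 - c] with velocity [v], and that [v] and [w]
    are two solutions, with Wronskian [k], of the linearised equation
    [y_ss + M y = 0].  Two independent periodic solutions would mean that the
    period of the oscillator is stationary in the energy, which never happens
    in a cubic potential.  The proof exhibits a strictly monotone quantity.
    With [v ^ 2 = P(M)], the second solution of the linearised equation is
    [y(M) - (5 * integral of v ^ 2) v] up to scale, for the quartic
    [y(M) = - (2 / 3) (M ^ 4 + 18 c M ^ 2 + 6 h M + 48 c ^ 2)], that is,
    [(y(M))_ss + M y(M) = 20 v ^ 2 v_s].  Hence the function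
    [G = (y(M))_s w - y(M) w_s - 5 v ^ 3 w], made of periodic terms, satisfies
    [G_s = - 5 k v ^ 2]. *)
Lemma oscillator_rigidity (T c k : R) (q M v w X : R -> R) : 0 < T -> k < 0 ->
  (forall t, 0 < q t) ->
  (forall t, is_derive M t (q t * v t)) ->
  (forall t, is_derive v t (- q t * (M t ^ 2 / 2 + c))) ->
  (forall t, is_derive w t (q t * X t)) ->
  (forall t, is_derive X t (- q t * M t * w t)) ->
  (forall t, v t * X t + (M t ^ 2 / 2 + c) * w t = k) ->
  (forall t, M (t + T) = M t) -> (forall t, v (t + T) = v t) ->
  (forall t, w (t + T) = w t) -> (forall t, X (t + T) = X t) ->
  forall t, v t = 0.
Proof.
  intros HT Hk Hq HM Hv Hw HX HW pM pv pw pX.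
  set (h := v 0 ^ 2 + M 0 ^ 3 / 3 + 2 * c * M 0).
  assert (Hh : forall t, v t ^ 2 = h - M t ^ 3 / 3 - 2 * c * M t).
  { intros t. apply (Rplus_eq_reg_r (M t ^ 3 / 3 + 2 * c * M t)).
    transitivity h; [|ring].
    rewrite <- Rplus_assoc.
    apply (derive_zero_const (fun t => v t ^ 2 + M t ^ 3 / 3 + 2 * c * M t)).
    intros s. generalize (HM s) (Hv s); intros H1 H2. derive_by field. }
  set (G := fun t =>
    (- (8 / 3 * M t ^ 3 + 24 * c * M t + 4 * h) * v t - 5 * v t ^ 3) * w t
    + 2 / 3 * (M t ^ 4 + 18 * c * M t ^ 2 + 6 * h * M t + 48 * c ^ 2) * X t).
  assert (HG : forall t, is_derive G t (-5 * k * q t * v t ^ 2)).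
  { intros t. generalize (HM t) (Hv t) (Hw t) (HX t); intros H1 H2 H3 H4.
    unfold G. rewrite <- (HW t). generalize (Hh t); intros H5.
    derive_by (apply Rminus_diag_uniq).
    (* Off the energy relation the two sides differ by a multiple of it. *)
    transitivity ((v t ^ 2 - (h - M t ^ 3 / 3 - 2 * c * M t)) *
      (q t * w t * (2 * M t ^ 2 - 4 * c))); [simpl; field|rewrite H5; ring]. }
  assert (H0 : forall t, -5 * k * q t * v t ^ 2 = 0).
  { apply (periodic_monotone G _ T HT); [|exact HG|].
    - intros t. unfold G. now rewrite pM, pv, pw, pX.
    - intros t. generalize (Hq t) (pow2_ge_0 (v t)); intros H1 H2.
      assert (0 <= -5 * k * q t) by nra. nra. }
  intros t. specialize (H0 t). specialize (Hq t).
  destruct (Req_dec (v t) 0) as [E|E]; [exact E|exfalso].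
  revert H0. apply Rmult_integral_contrapositive_currified; [|now apply pow_nonzero].
  apply Rgt_not_eq. nra.
Qed.

(** The Ermakov substitution [a = rho ^ 2] turns the equation into the
    autonomous oscillator of [oscillator_rigidity]: with
    [M = rho ^ 3 (rho'' + omega ^ 2 rho)] it reads [M' = b / rho ^ 3], and in the
    time [ds = dt / rho ^ 2] every solution [x] of [x'' + omega ^ 2 x = 0] gives a
    solution [x / rho] of [y_ss + M y = 0].  The two solutions used are
    [v = b / rho], which is also [M_s], and [w = b' / rho]; the derivative of [b]
    has the same period as [b], and their Wronskian is minus the energy of [b]. *)
Lemma no_periodic_resonance (omega T : R) (a a1 a2 a3 b b1 : R -> R) :
  0 < omega -> 0 < T ->
  (forall t, 0 < a t) ->
  (forall t, is_derive a t (a1 t)) -> (forall t, is_derive a1 t (a2 t)) ->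
  (forall t, is_derive a2 t (a3 t)) ->
  (forall t, is_derive b t (b1 t)) ->
  (forall t, is_derive b1 t (- omega ^ 2 * b t)) ->
  (forall t, a3 t + 4 * omega ^ 2 * a1 t = 2 * b t / sqrt (a t) ^ 5) ->
  (forall t, a (t + T) = a t) -> (forall t, a1 (t + T) = a1 t) ->
  (forall t, a2 (t + T) = a2 t) ->
  (forall t, b (t + T) = b t) -> (forall t, b1 (t + T) = b1 t) ->
  forall t, b t = 0.
Proof.
  intros Hom HT Ha Da Da1 Da2 Db Db1 Hode pa pa1 pa2 pb pb1.
  set (rho := fun t => sqrt (a t)).
  set (rho1 := fun t => a1 t / (2 * rho t)).
  assert (Hrho : forall t, 0 < rho t) by (intros t; apply sqrt_lt_R0, Ha).
  assert (Hrho2 : forall t, a t = rho t ^ 2).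
  { intros t. unfold rho. rewrite pow2_sqrt; [reflexivity|]. left; apply Ha. }
  assert (Drho : forall t, is_derive rho t (rho1 t)).
  { intros t. unfold rho1, rho. generalize (Da t) (Ha t) (Hrho t); intros H1 H2 H3.
    derive_by (field; apply Rgt_not_eq, H3). }
  assert (Ha1 : forall t, a1 t = 2 * rho t * rho1 t).
  { intros t. unfold rho1. field. apply Rgt_not_eq, Hrho. }
  set (M := fun t => a t * a2 t / 2 - a1 t ^ 2 / 4 + omega ^ 2 * a t ^ 2).
  set (v := fun t => b t / rho t).
  set (w := fun t => b1 t / rho t).
  set (W := fun t => rho t * b1 t - b t * rho1 t).
  set (X := fun t => - omega ^ 2 * b t * rho t - b1 t * rho1 t).
  set (q := fun t => / rho t ^ 2).
  set (E := fun t => omega ^ 2 * b t ^ 2 + b1 t ^ 2).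
  assert (HE : forall t, E t = E 0).
  { intros t. apply derive_zero_const. intros s. unfold E.
    generalize (Db s) (Db1 s); intros H1 H2. derive_by (simpl; ring). }
  assert (Drho1 : forall t, is_derive rho1 t (M t / rho t ^ 3 - omega ^ 2 * rho t)).
  { intros t. unfold rho1. generalize (Da1 t) (Drho t) (Hrho t); intros H1 H2 H3.
    derive_by (unfold M; rewrite (Hrho2 t), (Ha1 t); field; apply Rgt_not_eq, H3). }
  assert (DM : forall t, is_derive M t (q t * v t)).
  { intros t. generalize (Da t) (Da1 t) (Da2 t) (Hrho t); intros H1 H2 H3 H4.
    unfold M, q, v.
    assert (E3 : a3 t = 2 * b t / rho t ^ 5 - 4 * omega ^ 2 * a1 t)
      by (unfold rho; rewrite <- Hode; ring).
    derive_by (rewrite E3, (Hrho2 t); field; apply Rgt_not_eq, H4). }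
  assert (DW : forall t, is_derive W t (- M t * (q t * v t))).
  { intros t. generalize (Db t) (Db1 t) (Drho t) (Drho1 t) (Hrho t); intros H1 H2 H3 H4 H5.
    unfold W, q, v. derive_by (field; apply Rgt_not_eq, H5). }
  (* [W] is [v_s]; it differs from [- M ^ 2 / 2] by a constant since [M_s = v]. *)
  set (c := - (W 0 + M 0 ^ 2 / 2)).
  assert (Hc : forall t, W t = - (M t ^ 2 / 2 + c)).
  { intros t.
    assert (H : W t + M t ^ 2 / 2 = W 0 + M 0 ^ 2 / 2).
    { apply (derive_zero_const (fun t => W t + M t ^ 2 / 2)). intros s.
      generalize (DM s) (DW s); intros H1 H2. derive_by field. }
    unfold c. lra. }
  assert (HE0 : 0 <= E 0).
  { unfold E. generalize (pow2_ge_0 omega) (pow2_ge_0 (b 0)) (pow2_ge_0 (b1 0)); nra. }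
  assert (Hom2 : 0 < omega ^ 2) by now apply pow_lt.
  destruct (Rle_lt_or_eq_dec _ _ HE0) as [HEp|HEz].
  2: { intros t. specialize (HE t). rewrite <- HEz in HE. unfold E in HE.
       generalize (pow2_ge_0 (b t)) (pow2_ge_0 (b1 t)); intros H1 H2.
       assert (H3 : b t ^ 2 = 0) by nra.
       destruct (Req_dec (b t) 0) as [H4|H4]; [exact H4|].
       now apply (pow_nonzero _ 2) in H4. }
  assert (Hv : forall t, v t = 0).
  { apply (oscillator_rigidity T c (- E 0) q M v w X); auto.
    - lra.
    - intros t. unfold q. now apply Rinv_0_lt_compat, pow_lt.
    - intros t. generalize (Db t) (Drho t) (Hrho t); intros H1 H2 H3.
      replace (- q t * (M t ^ 2 / 2 + c)) with (q t * W t) by (rewrite Hc; ring).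
      unfold v, q, W. derive_by (field; apply Rgt_not_eq, H3).
    - intros t. generalize (Db1 t) (Drho t) (Hrho t); intros H1 H2 H3.
      unfold w, q, X. derive_by (field; apply Rgt_not_eq, H3).
    - intros t. generalize (Db t) (Db1 t) (Drho t) (Drho1 t) (Hrho t); intros H1 H2 H3 H4 H5.
      unfold X, w, q. derive_by (field; apply Rgt_not_eq, H5).
    - intros t. rewrite <- (HE t).
      replace (M t ^ 2 / 2 + c) with (- W t) by (rewrite Hc; ring).
      unfold v, X, W, w, E. field. apply Rgt_not_eq, Hrho.
    - intros t. unfold M. now rewrite pa, pa1, pa2.
    - intros t. unfold v, rho. now rewrite pa, pb.
    - intros t. unfold w, rho. now rewrite pa, pb1.
    - intros t. unfold X, rho1, rho. now rewrite pa, pa1, pb, pb1. }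
  intros t. replace (b t) with (v t * rho t).
  - rewrite Hv; ring.
  - unfold v; field. apply Rgt_not_eq, Hrho.
Qed.

(** * From invariants to the third-order equation *)

Lemma solves_intro (omega : R) (a a1 a2 a3 : R -> R) :
  (forall t, is_derive a t (a1 t)) -> (forall t, is_derive a1 t (a2 t)) ->
  (forall t, is_derive a2 t (a3 t)) ->
  (forall t, a3 t + 4 * omega ^ 2 * a1 t = 0) ->
  solves_third_order_ode omega a.
Proof.
  intros D1 D2 D3 H t.
  assert (E1 : forall s, a1 s = Derive_n a 1 s).
  { intros s. symmetry. apply is_derive_unique, D1. }
  assert (E2 : forall s, a2 s = Derive_n a 2 s).
  { intros s. symmetry. apply is_derive_unique.
    apply (is_derive_eq _ _ _ _ E1), D2. }
  assert (E3 : forall s, a3 s = Derive_n a 3 s).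
  { intros s. symmetry. apply is_derive_unique.
    apply (is_derive_eq _ _ _ _ E2), D3. }
  split.
  - intros [|[|[|[|k]]]] Hk; [exact I| | | |lia].
    + now exists (a1 t).
    + exists (a2 t). apply (is_derive_eq _ _ _ _ E1), D2.
    + exists (a3 t). apply (is_derive_eq _ _ _ _ E2), D3.
  - now rewrite <- E1, <- E3.
Qed.

Lemma solves_elim (omega : R) (a : R -> R) :
  solves_third_order_ode omega a ->
  exists a1 a2 : R -> R,
    (forall t, is_derive a t (a1 t)) /\ (forall t, is_derive a1 t (a2 t)) /\
    (forall t, is_derive a2 t (- 4 * omega ^ 2 * a1 t)).
Proof.
  intros H. exists (Derive_n a 1), (Derive_n a 2).
  repeat apply conj; intros t; destruct (H t) as [He Ho].
  - apply Derive_correct. exact (He 1%nat ltac:(lia)).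
  - apply Derive_correct. exact (He 2%nat ltac:(lia)).
  - replace (- 4 * omega ^ 2 * Derive_n a 1 t) with (Derive_n a 3 t) by lra.
    apply Derive_correct. exact (He 3%nat ltac:(lia)).
Qed.

Lemma periodic_derivative (f f1 : R -> R) (T : R) :
  (forall t, is_derive f t (f1 t)) -> (forall t, f (t + T) = f t) ->
  forall t, f1 (t + T) = f1 t.
Proof.
  intros Df pf t. rewrite <- (is_derive_unique _ _ _ (Df t)). symmetry.
  apply is_derive_unique. apply (is_derive_eq (fun s => f (s + T))); [exact pf|].
  generalize (Df (t + T)). generalize (f1 (t + T)). intros l H.
  auto_derive; [now exists l|].
  rewrite Rmult_1_l. now apply is_derive_unique.
Qed.

(** Divided by the constant of [proportional_to_alpha2], the function [al] becomes
    [alpha2], which is positive and as periodic as [g].  For [m = 2] the forcing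
    coefficient [be] inherits the period from the equation itself, because [g]
    does not vanish, so [no_periodic_resonance] applies to it. *)
Lemma invariant_ode (omega : R) (m : nat) (g : R -> R) :
  0 < omega -> (2 <= m)%nat -> (forall t, continuous g t) ->
  (forall t, g (t + 2 * PI) = g t) -> (forall t, g t <> 0) ->
  has_quadratic_invariant omega m g -> solves_third_order_ode omega (alpha2 m g).
Proof.
  intros Hom Hm Hg pg Hg0 (i0 & i1 & i2 & Hinv).
  destruct (invariant_structure omega m g i0 i1 i2 Hm Hg Hg0 Hinv) as
    (al & al1 & al2 & al3 & be & be1 & Hne & D1 & D2 & D3 & Db & Db1 & Dh & Hode & Hbe).
  destruct (proportional_to_alpha2 m g al al1 Hg0 Hne D1 Dh) as [c [Hc Hal]].
  set (a := alpha2 m g) in *.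
  assert (Ha0 : forall t, 0 < a t) by (intros t; apply Rpower_pos).
  assert (Da : forall t, is_derive a t (/ c * al1 t)).
  { intros t. apply (is_derive_eq (fun s => / c * al s)).
    - intros s. rewrite Hal. now field.
    - now apply (is_derive_scal al). }
  assert (Da1 : forall t, is_derive (fun s => / c * al1 s) t (/ c * al2 t))
    by (intros t; now apply (is_derive_scal al1)).
  assert (Da2 : forall t, is_derive (fun s => / c * al2 s) t (/ c * al3 t))
    by (intros t; now apply (is_derive_scal al2)).
  apply (solves_intro omega a _ _ _ Da Da1 Da2). intros t.
  enough (H : be t = 0).
  { transitivity (/ c * (al3 t + 4 * omega ^ 2 * al1 t)); [ring|].
    rewrite Hode, H. ring. }
  destruct (Nat.eq_dec m 2) as [->|Hm2]; [|now apply Hbe].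
  destruct (constant_sign g Hg Hg0) as [e [He Hsgn]].
  assert (Hsqrt : forall s, 0 < sqrt (a s)) by (intros s; apply sqrt_lt_R0, Ha0).
  assert (Hgs : forall s, g s = e / sqrt (a s) ^ 5).
  { intros s. rewrite (Hsgn s). unfold Rdiv. f_equal.
    rewrite (Rpower_alpha2 2 g s (Hg0 s)). fold a.
    rewrite <- (Rpower_pow 5) by apply Hsqrt.
    rewrite <- (Rpower_sqrt _ (Ha0 s)), Rpower_mult, <- Rpower_Ropp.
    f_equal. simpl. field. }
  assert (Hf : forall s, / c * al3 s + 4 * omega ^ 2 * (/ c * al1 s)
    = 2 * (e / c * be s) / sqrt (a s) ^ 5).
  { intros s. transitivity (/ c * (al3 s + 4 * omega ^ 2 * al1 s)); [ring|].
    rewrite Hode, Hgs. field. split; [exact Hc|apply Rgt_not_eq, Hsqrt]. }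
  assert (pa : forall s, a (s + 2 * PI) = a s) by (intros s; unfold a, alpha2; now rewrite pg).
  pose proof (periodic_derivative _ _ _ Da pa) as pa1.
  pose proof (periodic_derivative _ _ _ Da1 pa1) as pa2.
  pose proof (periodic_derivative _ _ _ Da2 pa2) as pa3.
  assert (Dbs : forall s, is_derive (fun s => e / c * be s) s (e / c * be1 s))
    by (intros s; now apply (is_derive_scal be)).
  assert (pb : forall s, e / c * be (s + 2 * PI) = e / c * be s).
  { intros s. generalize (Hf s) (Hf (s + 2 * PI)). simpl in pa1, pa2, pa3.
    rewrite pa1, pa3, pa. intros -> H.
    assert (H5 : sqrt (a s) ^ 5 <> 0) by (apply pow_nonzero, Rgt_not_eq, Hsqrt).
    apply (Rmult_eq_reg_l (2 / sqrt (a s) ^ 5)).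
    - unfold Rdiv in *. rewrite (Rmult_comm 2), !Rmult_assoc, (Rmult_comm (/ _)), (Rmult_comm (/ sqrt _ ^ 5)). lra.
    - unfold Rdiv. apply Rmult_integral_contrapositive_currified; [lra|].
      now apply Rinv_neq_0_compat. }
  assert (Hb : e / c * be t = 0).
  { generalize PI_RGT_0; intros HPI.
    apply (no_periodic_resonance omega (2 * PI) a (fun s => / c * al1 s) (fun s => / c * al2 s)
      (fun s => / c * al3 s) (fun s => e / c * be s) (fun s => e / c * be1 s)); auto.
    - lra.
    - intros s. replace (- omega ^ 2 * (e / c * be s)) with (e / c * (- omega ^ 2 * be s)) by ring.
      now apply (is_derive_scal be1).
    - exact (periodic_derivative _ _ _ Dbs pb). }
  apply Rmult_integral in Hb. destruct Hb as [Hb|Hb]; [|exact Hb].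
  exfalso. apply Rmult_integral in Hb. destruct Hb as [Hb|Hb].
  - nra.
  - now apply Rinv_neq_0_compat in Hb.
Qed.

(** * From the third-order equation to invariants *)

Lemma C1_2d_plus (f k : R -> R -> R) :
  C1_2d f -> C1_2d k -> C1_2d (fun x t => f x t + k x t).
Proof.
  intros Hf Hk x t.
  destruct (Hf x t) as (f1 & f2 & f3 & f4). destruct (Hk x t) as (k1 & k2 & k3 & k4).
  repeat apply conj.
  - now apply (ex_derive_plus (fun y => f y t)).
  - now apply (ex_derive_plus (f x)).
  - eapply continuity_2d_pt_ext; [|exact (continuity_2d_pt_plus _ _ _ _ f3 k3)].
    intros y s. destruct (Hf y s) as (e1 & _). destruct (Hk y s) as (e2 & _).
    symmetry. now apply (Derive_plus (fun y => f y s)).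
  - eapply continuity_2d_pt_ext; [|exact (continuity_2d_pt_plus _ _ _ _ f4 k4)].
    intros y s. destruct (Hf y s) as (_ & e1 & _). destruct (Hk y s) as (_ & e2 & _).
    symmetry. now apply (Derive_plus (f y)).
Qed.

Lemma continuity_2d_pt_separated (f k : R -> R) (x t : R) :
  continuous f t -> continuous k x -> continuity_2d_pt (fun y s => f s * k y) x t.
Proof.
  intros Hf Hk. apply continuity_2d_pt_mult.
  - apply (continuity_1d_2d_pt_comp f (fun _ s => s)); [|apply continuity_2d_pt_id2].
    now apply continuity_pt_filterlim.
  - apply (continuity_1d_2d_pt_comp k (fun y _ => y)); [|apply continuity_2d_pt_id1].
    now apply continuity_pt_filterlim.
Qed.

Lemma C1_2d_monomial (c c1 : R -> R) (n : nat) :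
  (forall t, is_derive c t (c1 t)) -> (forall t, continuous c1 t) ->
  C1_2d (fun x t => c t * x ^ n).
Proof.
  intros Dc Hc1.
  assert (Dx : forall x t, is_derive (fun y => c t * y ^ n) x (c t * (INR n * x ^ pred n))).
  { intros x t. generalize (c t). intros k. auto_derive; [exact I|ring]. }
  assert (Dt : forall x t, is_derive (fun s => c s * x ^ n) t (c1 t * x ^ n)).
  { intros x t. generalize (Dc t) (x ^ n). intros H y. derive_by ring. }
  intros x t. repeat apply conj.
  - now exists (c t * (INR n * x ^ pred n)).
  - now exists (c1 t * x ^ n).
  - apply continuity_2d_pt_ext with (fun y s => c s * (INR n * y ^ pred n)).
    + intros y s. symmetry. apply is_derive_unique, Dx.
    + apply (continuity_2d_pt_separated c (fun y => INR n * y ^ pred n)).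
      * now apply is_derive_continuous with (c1 t).
      * apply (ex_derive_continuous (fun y => INR n * y ^ pred n)). auto_derive. exact I.
  - apply continuity_2d_pt_ext with (fun y s => c1 s * y ^ n).
    + intros y s. symmetry. apply is_derive_unique, Dt.
    + apply (continuity_2d_pt_separated c1 (fun y => y ^ n)); [apply Hc1|apply continuous_pow].
Qed.

(** The solution of the determining equations with [a2 = alpha2] and [be = 0].  The
    relation [g = e * alpha2 ^ (- (m + 3) / 2)], with [e] a constant sign, makes
    [alpha2 * g] continuously differentiable. *)
Lemma ode_invariant (omega : R) (m : nat) (g : R -> R) :
  (forall t, continuous g t) -> (forall t, g t <> 0) ->
  solves_third_order_ode omega (alpha2 m g) -> has_quadratic_invariant omega m g.
Proof.
  intros Hg Hg0 Hode.
  destruct (solves_elim _ _ Hode) as (a1 & a2 & Da & Da1 & Da2).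
  destruct (constant_sign g Hg Hg0) as [e [_ Hsgn]].
  assert (Hgp : forall t, g t = e * Rpower (alpha2 m g t) (- (INR m + 3) / 2)).
  { intros t. rewrite <- Rpower_alpha2 by apply Hg0. apply Hsgn. }
  set (a := alpha2 m g) in *.
  assert (Ha0 : forall t, 0 < a t) by (intros t; apply Rpower_pos).
  assert (Hm1 : INR m + 1 <> 0) by (generalize (pos_INR m); lra).
  set (c2 := fun t => a2 t / 2 + omega ^ 2 * a t).
  set (c3 := fun t => 2 / (INR m + 1) * (a t * g t)).
  assert (Dc2 : forall t, is_derive c2 t (- omega ^ 2 * a1 t)).
  { intros t. generalize (Da t) (Da2 t); intros H1 H2. unfold c2.
    clearbody a. derive_by field. }
  assert (Dc3 : forall t, is_derive c3 t (- a1 t * g t)).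
  { intros t. unfold c3. rewrite (Hgp t).
    apply (is_derive_eq (fun s => 2 / (INR m + 1) *
      (a s * (e * exp (- (INR m + 3) / 2 * ln (a s)))))).
    - intros s. now rewrite (Hgp s).
    - generalize (Da t) (Ha0 t); intros H1 H2. clear Hgp. clearbody a. unfold Rpower.
      derive_by (field; split; [apply Rgt_not_eq, H2|exact Hm1]). }
  exists (fun x t => c2 t * x ^ 2 + c3 t * x ^ S m), (fun x t => - a1 t * x ^ 1),
    (fun x t => a t * x ^ 0).
  assert (Ca1 : forall t, continuous a1 t)
    by (intros t; now apply is_derive_continuous with (a2 t)).
  assert (Ca2 : forall t, continuous a2 t)
    by (intros t; apply (is_derive_continuous _ _ _ (Da2 t))).
  repeat apply conj.
  - apply C1_2d_plus.
    + apply (C1_2d_monomial c2 _ 2 Dc2). intros t.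
      apply (continuous_mult (fun _ => - omega ^ 2) a1); [apply continuous_const|apply Ca1].
    + apply (C1_2d_monomial c3 _ (S m) Dc3). intros t.
      apply (continuous_mult (fun t => - a1 t) g); [|apply Hg].
      now apply (continuous_opp a1).
  - apply (C1_2d_monomial (fun t => - a1 t) (fun t => - a2 t)).
    + intros t. now apply (is_derive_opp a1).
    + intros t. now apply (continuous_opp a2).
  - now apply (C1_2d_monomial a a1).
  - exists 0, 0. rewrite Rmult_1_r. apply Rgt_not_eq, Ha0.
  - intros lo hi z Hsol t Hlo Hhi.
    destruct (Hsol t Hlo Hhi) as (E1 & E2 & Heq).
    set (Z := Derive z) in *.
    assert (Dz : is_derive z t (Z t)) by now apply Derive_correct.
    assert (DZ : is_derive Z t (- (omega ^ 2 * z t + g t * z t ^ m))).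
    { replace (- (omega ^ 2 * z t + g t * z t ^ m)) with (Derive_n z 2 t) by lra.
      now apply (Derive_correct (Derive z)). }
    assert (D0 : is_derive (fun s => c2 s * z s ^ 2 + c3 s * z s ^ S m) t
      (- omega ^ 2 * a1 t * z t ^ 2 + 2 * c2 t * z t * Z t
       - a1 t * g t * z t ^ S m + 2 * a t * g t * z t ^ m * Z t)).
    { replace (2 * a t * g t) with ((INR m + 1) * c3 t) by (unfold c3; now field).
      generalize (Dc2 t) (Dc3 t); intros H1 H2. clearbody c2 c3 Z.
      derive_by idtac.
      change (match m with O => 1 | S _ => INR m + 1 end) with (INR (S m)).
      rewrite S_INR. simpl. ring. }
    assert (D1 : is_derive (fun s => - a1 s * z s ^ 1) t (- a2 t * z t - a1 t * Z t)).
    { generalize (Da1 t); intros H1. clearbody Z. derive_by (simpl; ring). }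
    assert (D2 : is_derive (fun s => a s * z s ^ 0) t (a1 t)).
    { apply (is_derive_eq a); [intros s; simpl; ring|apply Da]. }
    replace 0 with
      ((- omega ^ 2 * a1 t * z t ^ 2 + 2 * c2 t * z t * Z t
        - a1 t * g t * z t ^ S m + 2 * a t * g t * z t ^ m * Z t)
       + ((- a2 t * z t - a1 t * Z t) * Z t
          + (- a1 t * z t ^ 1) * (- (omega ^ 2 * z t + g t * z t ^ m)))
       + (a1 t * Z t ^ 2
          + 2 * (a t * z t ^ 0) * Z t * (- (omega ^ 2 * z t + g t * z t ^ m)))).
    + exact (is_derive_quadratic _ _ _ _ _ _ _ _ _ D0 D1 D2 DZ).
    + unfold c2. simpl. field.
Qed.

(** * Trigonometric solutions *)

(** Variation of constants: [A], [B] and [C] are the first integrals that recover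
    the coefficients from [a], [a'] and [a'']. *)
Lemma ode_trig (omega : R) (a : R -> R) : 0 < omega ->
  solves_third_order_ode omega a ->
  exists A B C : R, forall t, a t = trig omega A B C t.
Proof.
  intros Hom Hode.
  destruct (solves_elim _ _ Hode) as (a1 & a2 & Da & Da1 & Da2).
  set (A := fun t => a t + a2 t / (4 * omega ^ 2)).
  set (B := fun t => - (a2 t * cos (2 * omega * t)) / (4 * omega ^ 2)
    - a1 t * sin (2 * omega * t) / (2 * omega)).
  set (C := fun t => - (a2 t * sin (2 * omega * t)) / (4 * omega ^ 2)
    + a1 t * cos (2 * omega * t) / (2 * omega)).
  exists (A 0), (B 0), (C 0). intros t.
  assert (Hom0 : omega <> 0) by lra.
  rewrite (derive_zero_const A) with (t := t), (derive_zero_const B) with (t := t),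
    (derive_zero_const C) with (t := t).
  - unfold trig, A, B, C.
    assert (H : cos (2 * omega * t) ^ 2 = 1 - sin (2 * omega * t) ^ 2).
    { generalize (sin2_cos2 (2 * omega * t)). unfold Rsqr. lra. }
    field_simplify; [|exact Hom0]. rewrite H. field. exact Hom0.
  - intros s. generalize (Da1 s) (Da2 s); intros H1 H2. unfold C.
    derive_by (field; exact Hom0).
  - intros s. generalize (Da1 s) (Da2 s); intros H1 H2. unfold B.
    derive_by (field; exact Hom0).
  - intros s. generalize (Da s) (Da2 s); intros H1 H2. unfold A.
    derive_by (field; exact Hom0).
Qed.

Lemma trig_ode (omega A B C : R) (a : R -> R) :
  (forall t, a t = trig omega A B C t) -> solves_third_order_ode omega a.
Proof.
  intros Ha.
  apply (solves_intro omega a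
    (fun t => 2 * omega * (C * cos (2 * omega * t) - B * sin (2 * omega * t)))
    (fun t => - 4 * omega ^ 2 * (B * cos (2 * omega * t) + C * sin (2 * omega * t)))
    (fun t => - 8 * omega ^ 3 * (C * cos (2 * omega * t) - B * sin (2 * omega * t)))).
  - intros t. apply (is_derive_eq (trig omega A B C)); [now intros s|].
    unfold trig. auto_derive; [exact I|ring].
  - intros t. auto_derive; [exact I|ring].
  - intros t. auto_derive; [exact I|ring].
  - intros t. ring.
Qed.

(** * The equivalences *)

Theorem mainTheorem1 (omega : R) (m : nat) (g : R -> R)
    (homega : 0 < omega) (hm : (2 <= m)%nat)
    (gcont : forall t : R, continuous g t)
    (gper : forall t : R, g (t + 2 * PI) = g t)
    (gneq0 : forall t : R, g t <> 0) :
  (has_quadratic_invariant omega m g <->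
   solves_third_order_ode omega (alpha2 m g)) /\
  (solves_third_order_ode omega (alpha2 m g) <->
   exists A B C : R, forall t : R,
     0 < trig omega A B C t /\
     Rabs (g t) = Rpower (trig omega A B C t) (- (INR m + 3) / 2)) /\
  (m = 2%nat ->
   (has_quadratic_invariant omega m g <->
    exists A B C : R, forall t : R,
      0 < trig omega A B C t /\
      Rabs (g t) = Rpower (trig omega A B C t) (- 5 / 2))).
Proof.
  assert (Hinv : has_quadratic_invariant omega m g <->
    solves_third_order_ode omega (alpha2 m g)).
  { split; [now apply invariant_ode|now apply ode_invariant]. }
  assert (Htrig : solves_third_order_ode omega (alpha2 m g) <->
    exists A B C : R, forall t : R,
      0 < trig omega A B C t /\
      Rabs (g t) = Rpower (trig omega A B C t) (- (INR m + 3) / 2)).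
  { split.
    - intros H. destruct (ode_trig omega _ homega H) as (A & B & C & HABC).
      exists A, B, C. intros t. rewrite <- HABC. split; [apply Rpower_pos|].
      now apply Rpower_alpha2.
    - intros (A & B & C & HABC). apply (trig_ode omega A B C). intros t.
      destruct (HABC t). now apply alpha2_Rpower. }
  split; [exact Hinv|]. split; [exact Htrig|].
  intros ->. rewrite Hinv, Htrig.
  replace (- (INR 2 + 3) / 2) with (- 5 / 2) by (simpl; lra). reflexivity.
Qed.
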